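(* Let $N\ge1$ and $A\in\mathbb{R}^{N\times N}$. The following are equivalent: (i) $A$ is an Erdős matrix; (ii) $A=\operatorname{proj}_{\operatorname{aff}F}(0)$ for some centered face $F$ of $\Pi_N$, and $A\neq\operatorname{proj}_{F'}(0)$ for any non-centered face $F'$ of $\Pi_N$ containing $F$.
   Context: $\Pi_N\subset\mathbb{R}^{N\times N}$ is the Birkhoff polytope of doubly stochastic matrices (nonnegative entries, all row and column sums equal to $1$). $\mathbb{R}^{N\times N}$ carries the Frobenius inner product $\langle B,A\rangle=\sum_{i,j}b_{ij}a_{ij}$ and norm $\|A\|^2=\sum_{i,j}a_{ij}^2$. The maximal trace of $A$ is $\operatorname{max\,tr}A=\max_\sigma\sum_{i=1}^N a_{i,\sigma(i)}$, where $\sigma$ ranges over all permutations of $\{1,\dots,N\}$. $A$ is called an Erdős matrix if $A\in\Pi_N$ and $\|A\|^2=\operatorname{max\,tr}A$. A face of a polytope $\mathcal{P}$ is a convex subset $F\subset\mathcal{P}$ such that any open line segment $L=(x,y)\subset\mathcal{P}$ with $L\cap F\neq\emptyset$ satisfies $[x,y]\subset F$ ($\mathcal{P}$ itself is a face); here faces are taken nonempty. $\operatorname{aff}F$ is the affine hull. For a nonempty closed convex set $K$, $\operatorname{proj}_K(0)$ is the unique minimum-norm point of $K$. A face $F$ of $\Pi_N$ is called centered if $\operatorname{proj}_{\operatorname{aff}F}(0)\in F$, and non-centered otherwise. *)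

(* Defs.v *)
From HB Require Import structures.
From mathcomp Require Import all_boot all_order all_algebra all_fingroup.
From mathcomp Require Import boolp classical_sets set_interval reals interval_inference convex.
From mathcomp Require Import ring lra.

Set Implicit Arguments.
Unset Strict Implicit.
Unset Printing Implicit Defensive.

Import Order.TTheory GRing.Theory Num.Theory.
Local Open Scope classical_set_scope.
Local Open Scope ring_scope.

Section Matrices.
Variables (R : realType) (N : nat).
Implicit Types (A B X Y : 'M[R]_N) (F P K : set 'M[R]_N).

Definition birkhoff : set 'M[R]_N :=
  [set A | [/\ forall i j, 0 <= A i j,
               forall i, \sum_j A i j = 1 &
               forall j, \sum_i A i j = 1]].

Definition frob_dot B A : R := \sum_i \sum_j B i j * A i j.

Definition frob_norm A : R := Num.sqrt (frob_dot A A).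

Definition perm_trace A (s : 'S_N) : R := \sum_i A i (s i).

(* The default value is the term of the identity permutation, so that this is
   a genuine maximum over 'S_N even if all the terms are negative; see
   max_trP. *)
Definition max_tr A : R :=
  \big[Num.max/perm_trace A 1%g]_(s : 'S_N) perm_trace A s.

Definition erdos_matrix A : Prop :=
  birkhoff A /\ frob_norm A ^+ 2 = max_tr A.

Definition open_segment X Y : set 'M[R]_N :=
  [set (1 - t) *: X + t *: Y | t in `]0, 1[].

Definition closed_segment X Y : set 'M[R]_N :=
  [set (1 - t) *: X + t *: Y | t in `[0, 1]].

Definition face P F : Prop :=
  [/\ F !=set0, F `<=` P, @convex_set R 'M[R]_N F &
      forall X Y, open_segment X Y `<=` P ->
        open_segment X Y `&` F !=set0 -> closed_segment X Y `<=` F].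

Definition affine_hull F : set 'M[R]_N :=
  [set X | exists n (c : 'I_n -> R) (Y : 'I_n -> 'M[R]_N),
     [/\ forall i, F (Y i), \sum_i c i = 1 & X = \sum_i c i *: Y i]].

Definition min_norm_point K : set 'M[R]_N :=
  [set X | K X /\ forall Y, K Y -> frob_norm X <= frob_norm Y].

(* The junk value 0 is only returned when K has no minimum-norm point, hence
   never on a nonempty closed convex set; uniqueness is min_norm_point_uniq. *)
Definition proj0 K : 'M[R]_N := xget 0 (min_norm_point K).

Definition centered F : Prop := F (proj0 (affine_hull F)).

Lemma frob_dot_ge0 A : 0 <= frob_dot A A.
Proof. by apply: sumr_ge0 => i _; apply: sumr_ge0 => j _; rewrite -expr2 sqr_ge0. Qed.

Lemma frob_norm_sqr A : frob_norm A ^+ 2 = \sum_i \sum_j A i j ^+ 2.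
Proof. by rewrite sqr_sqrtr ?frob_dot_ge0. Qed.

Lemma max_trP A :
  (exists s, max_tr A = perm_trace A s) /\
  (forall s, perm_trace A s <= max_tr A).
Proof.
split; last by move=> s; rewrite /max_tr; apply: le_bigmax.
rewrite /max_tr; apply: (big_ind (fun x => exists s, x = perm_trace A s)).
- by exists 1%g.
- by move=> x y [s ->] [t ->]; rewrite maxEle; case: ifP => _; [exists t | exists s].
- by move=> s _; exists s.
Qed.

Lemma min_norm_point_uniq K :
  @convex_set R 'M[R]_N K -> is_subset1 (min_norm_point K).
Proof.
move=> cK X Y [KX mX] [KY mY].
have KM : K (2^-1 *: X + 2^-1 *: Y).
  have h0 : 0 <= (2^-1 : R) by lra.
  have h1 : (2^-1 : R) <= 1 by lra.
  have := cK X Y (Itv01 h0 h1) (mem_set KX) (mem_set KY) => /set_mem.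
  have -> : 2^-1 *: X + 2^-1 *: Y = 2^-1 *: X + (1 - 2^-1) *: Y.
    by congr (_ + _ *: _); lra.
  by [].
have eXY : frob_dot X X = frob_dot Y Y.
  rewrite -[LHS]sqr_sqrtr ?frob_dot_ge0// -[RHS]sqr_sqrtr ?frob_dot_ge0//.
  by congr (_ ^+ 2); apply/eqP; rewrite eq_le mX// mY.
have := mX _ KM; rewrite ler_sqrt ?frob_dot_ge0// => leM.
have E : frob_dot (X - Y) (X - Y) =
    2 * frob_dot X X + 2 * frob_dot Y Y -
    4 * frob_dot (2^-1 *: X + 2^-1 *: Y) (2^-1 *: X + 2^-1 *: Y).
  rewrite /frob_dot !mulr_sumr -sumrN -!big_split; apply: eq_bigr => i _ /=.
  rewrite !mulr_sumr -sumrN -!big_split; apply: eq_bigr => j _ /=.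
  by rewrite !mxE; field.
have D0 : frob_dot (X - Y) (X - Y) = 0.
  by apply/eqP; rewrite eq_le frob_dot_ge0 andbT; lra.
apply/matrixP => i j; apply/eqP; rewrite -subr_eq0 -sqrf_eq0.
have sq0 k l : 0 <= (X - Y) k l * (X - Y) k l by rewrite -expr2 sqr_ge0.
have /(_ i isT) := psumr_eq0P (fun k _ => sumr_ge0 _ (fun l _ => sq0 k l)) D0.
by move=> /(psumr_eq0P (fun l _ => sq0 i l)) /(_ j isT); rewrite !mxE expr2 => ->.
Qed.

End Matrices.

Arguments birkhoff R N : clear implicits.

(* Main.v *)
(** For [B] in the Birkhoff polytope, [<B, A> <= max_tr A] by linear programming
    duality for the assignment problem; so [A] is an Erdős matrix iff it lies in
    the polytope and [<B, A> <= |A|^2] there.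
    If so, [F := {B | <B, A> = |A|^2}] is a centered face whose affine hull has
    [A] as its minimum-norm point, and [A = proj0 F'] forces [<B, A> >= |A|^2] on
    [F'], hence [F' `<=` F].
    Conversely, let [A = proj0 (affine_hull F)] with [F] centered; then [<., A>]
    is the constant [|A|^2] on [F].  If it is larger somewhere in the polytope,
    take a minimal face [F'] that contains [F] and a point where it is larger.
    By minimality [<., A> >= |A|^2] on [F'], so [A = proj0 F']; and [F'] is not
    centered, since otherwise [<., A>] would be constant on it. *)
Require Import Defs.
From mathcomp Require Import all_boot all_order all_algebra.
From mathcomp Require Import all_fingroup.
From mathcomp Require Import boolp classical_sets reals.
From mathcomp Require Import interval_inference convex.
From mathcomp Require Import ring lra.

Import Order.TTheory GRing.Theory Num.Theory.
Local Open Scope classical_set_scope.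
Local Open Scope ring_scope.

(** * Potentials on a weighted digraph without positive cycles *)

Section WalkWeight.
Context {R : realType} {T : finType}.
Variable w : T -> T -> R.

(** A walk is its start [x] with the list [p] of its later vertices; [rcons p x] closes it up. *)
Fixpoint walk_weight (x : T) (p : seq T) : R :=
  if p is y :: p' then w x y + walk_weight y p' else 0.

Lemma walk_weight_cat x p q :
  walk_weight x (p ++ q) = walk_weight x p + walk_weight (last x p) q.
Proof. by elim: p x => [|y p IH] x /=; rewrite ?add0r// IH addrA. Qed.

Lemma walk_weight_sum x0 x p :
  walk_weight x p = \sum_(k < size p) w (nth x0 (x :: p) k) (nth x0 p k).
Proof.
elim: p x => [|y p IH] x; first by rewrite big_ord0.
by rewrite big_ord_recl /= IH.
Qed.

Lemma sum_next_cycle x p : uniq (x :: p) ->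
  \sum_(i in x :: p) w i (next (x :: p) i) = walk_weight x (rcons p x).
Proof.
move=> Up; rewrite -big_uniq// (big_nth x) big_mkord (walk_weight_sum x).
rewrite size_rcons; apply: eq_bigr => k _.
rewrite next_nth mem_nth// index_uniq//.
have -> : nth x (x :: rcons p x) k = nth x (x :: p) k.
  by rewrite -rcons_cons nth_rcons (ltn_ord k).
rewrite nth_rcons; case: ltnP => // le_pk.
by rewrite if_same (nth_default x le_pk).
Qed.

Hypothesis cycle_le0 : forall x p, uniq (x :: p) -> walk_weight x (rcons p x) <= 0.

Lemma walk_weight_uniq x p :
  exists2 q, uniq (x :: q) & walk_weight x p <= walk_weight x q.
Proof.
elim: p x => [|y p IH] x; first by exists [::].
have [q Uq le_pq] := IH y.
have [xq|xq] := boolP (x \in y :: q); last first.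
  by exists (y :: q); rewrite ?cons_uniq ?xq// lerD2l.
have le_w : walk_weight x (y :: p) <= walk_weight x (y :: q) by rewrite lerD2l.
case/splitPr: xq Uq le_w => q1 q2 Uq le_w; exists q2.
  by move: Uq; rewrite cat_uniq => /and3P[].
apply: (le_trans le_w); rewrite -cat_rcons walk_weight_cat last_rcons.
rewrite gerDr; apply: cycle_le0.
by rewrite uniq_catC /= in Uq; move: Uq; rewrite mem_cat cat_uniq !negb_or /=
  => /andP[/andP[_ ->] /and3P[_ _ ->]].
Qed.

Lemma walk_weight_le x p :
  walk_weight x p <= #|T|%:R * \sum_i \sum_j `|w i j|.
Proof.
set K := \sum_i _.
have K0 : 0 <= K by apply: sumr_ge0 => i _; apply: sumr_ge0 => j _.
have wK i j : w i j <= K.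
  rewrite (le_trans (ler_norm _))// /K (bigD1 i)//= (bigD1 j)//= -addrA.
  rewrite lerDl addr_ge0// sumr_ge0// => k _; exact: sumr_ge0.
have size_bound y q : walk_weight y q <= (size q)%:R * K.
  elim: q y => [|z q IH] y /=; first by rewrite mul0r.
  by rewrite -natr1 mulrDl mul1r addrC lerD.
have [q Uq le_pq] := walk_weight_uniq x p.
apply: (le_trans le_pq); apply: (le_trans (size_bound _ _)).
apply: ler_wpM2r => //; rewrite ler_nat.
by move: Uq => /card_uniqP/= Uq; rewrite ltnW// -Uq max_card.
Qed.

(** The supremum of the weights of all walks from [i] is a potential: a step from [i] to [j] can be
    prepended to any walk from [j]. *)
Lemma potential_exists : exists u : T -> R, forall i j, w i j <= u i - u j.
Proof.
pose W i := [set r | exists p, r = walk_weight i p].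
have ubW i : has_ubound (W i).
  by eexists => _ [p ->]; exact: walk_weight_le.
exists (fun i => sup (W i)) => i j; rewrite lerBrDr addrC -lerBrDr.
apply: ge_sup; first by exists 0, [::].
move=> _ [p ->]; rewrite lerBrDr addrC; apply: ub_le_sup => //.
by exists (j :: p).
Qed.

End WalkWeight.

(** * The Frobenius inner product and minimum-norm points *)

Section Frobenius.
Context {R : realType} {N : nat}.
Implicit Types (A B C E M X Y Z : 'M[R]_N) (F K : set 'M[R]_N).

Lemma frob_dotC X Y : frob_dot X Y = frob_dot Y X.
Proof. by apply: eq_bigr => i _; apply: eq_bigr => j _; rewrite mulrC. Qed.

Lemma frob_dotDl X Y Z : frob_dot (X + Y) Z = frob_dot X Z + frob_dot Y Z.
Proof.
rewrite -big_split; apply: eq_bigr => i _.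
by rewrite -big_split; apply: eq_bigr => j _; rewrite mxE mulrDl.
Qed.

Lemma frob_dotZl a X Z : frob_dot (a *: X) Z = a * frob_dot X Z.
Proof.
rewrite mulr_sumr; apply: eq_bigr => i _.
by rewrite mulr_sumr; apply: eq_bigr => j _; rewrite mxE mulrA.
Qed.

Lemma frob_dotBl X Y Z : frob_dot (X - Y) Z = frob_dot X Z - frob_dot Y Z.
Proof. by rewrite frob_dotDl -scaleN1r frob_dotZl mulN1r. Qed.

Lemma frob_dot_suml n (c : 'I_n -> R) (Y : 'I_n -> 'M[R]_N) Z :
  frob_dot (\sum_i c i *: Y i) Z = \sum_i c i * frob_dot (Y i) Z.
Proof.
apply: (big_ind2 (fun X r => frob_dot X Z = r)).
- by rewrite -(scale0r 0) frob_dotZl mul0r.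
- by move=> X x Y' y <- <-; rewrite frob_dotDl.
- by move=> i _; rewrite frob_dotZl.
Qed.

Lemma frob_dot_sub X Y :
  frob_dot (X - Y) (X - Y) = frob_dot X X - 2 * frob_dot X Y + frob_dot Y Y.
Proof.
rewrite frob_dotBl !(frob_dotC _ (X - Y)) !frob_dotBl (frob_dotC Y X).
by ring.
Qed.

Lemma frob_dot_le0 X : frob_dot X X <= 0 -> X = 0.
Proof.
move=> X_le0; have X0 : frob_dot X X = 0.
  by apply/eqP; rewrite eq_le X_le0 frob_dot_ge0.
have sq0 k l : 0 <= X k l * X k l by rewrite -expr2 sqr_ge0.
apply/matrixP => i j; rewrite mxE.
have /(_ i isT) := psumr_eq0P (fun k _ => sumr_ge0 _ (fun l _ => sq0 k l)) X0.
move=> /(psumr_eq0P (fun l _ => sq0 i l)) /(_ j isT)/eqP.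
by rewrite mulf_eq0 orbb => /eqP.
Qed.

Lemma frob_norm_le X Y : (frob_norm X <= frob_norm Y) = (frob_dot X X <= frob_dot Y Y).
Proof. by rewrite ler_sqrt ?frob_dot_ge0. Qed.

(** On [K], [|B - A|^2 = |B|^2 - 2<B, A> + |A|^2 <= |B|^2 - |A|^2], which gives minimality and
    uniqueness at once. *)
Lemma proj0_eq K A :
  K A -> (forall B, K B -> frob_dot A A <= frob_dot B A) -> proj0 K = A.
Proof.
move=> KA leA; have minA : min_norm_point K A.
  split=> // B KB; rewrite frob_norm_le.
  by have := frob_dot_ge0 (B - A); rewrite frob_dot_sub; have := leA _ KB; lra.
apply: xget_unique => // B [KB]; move=> /(_ _ KA); rewrite frob_norm_le => leBA.
apply/esym/eqP; rewrite eq_sym -subr_eq0; apply/eqP/frob_dot_le0.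
by rewrite frob_dot_sub; have := leA _ KB; lra.
Qed.

(** The default value of [proj0] is 0, so any other value is genuine. *)
Lemma proj0_min K : proj0 K != 0 -> min_norm_point K (proj0 K).
Proof. by rewrite /proj0; case: xgetP => [X _ //|_]; rewrite eqxx. Qed.

(** First-order condition: if [<B - A, A> < 0], the norm drops on leaving [A] towards [B]. *)
Lemma min_segment A B :
  (forall t, 0 <= t <= 1 ->
     frob_norm A <= frob_norm (A + t *: (B - A))) ->
  frob_dot A A <= frob_dot B A.
Proof.
move=> minA; rewrite leNgt; apply/negP => lt_BA.
set q := frob_dot (B - A) (B - A); set d := frob_dot (B - A) A.
have d_lt0 : d < 0 by rewrite /d frob_dotBl subr_lt0.
have q_ge0 : 0 <= q by exact: frob_dot_ge0.
have qd_gt0 : 0 < q - d by lra.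
(* The unconstrained minimiser is [- d / q]; the larger denominator ensures [t <= 1], and still
   [2d + tq = d + td < 0]. *)
pose t := - d / (q - d).
have t_gt0 : 0 < t by rewrite divr_gt0// oppr_gt0.
have t_le1 : t <= 1 by rewrite ler_pdivrMr// mul1r; lra.
have := minA t; rewrite (ltW t_gt0) t_le1 => /(_ isT); rewrite frob_norm_le.
rewrite frob_dotDl !(frob_dotC _ (A + _)) !frob_dotDl !frob_dotZl.
rewrite !(frob_dotC _ (t *: _)) !frob_dotZl -/d -/q.
have tE : t * (q - d) = - d by rewrite divfK ?gt_eqF.
have tdd : t * d < 0 by rewrite nmulr_llt0.
have -> : frob_dot A A + t * d + (t * d + t * (t * q)) =
  frob_dot A A + t * (2 * d + t * (q - d) + t * d) by ring.
rewrite tE.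
have : t * (2 * d - d + t * d) < 0 by rewrite pmulr_rlt0//; lra.
by lra.
Qed.

Lemma convex_setE K X Y t : @convex_set R 'M[R]_N K -> K X -> K Y ->
  0 <= t <= 1 -> K (X + t *: (Y - X)).
Proof.
move=> cK KX KY /andP[t0 t1].
have := cK Y X (Itv01 t0 t1) (mem_set KY) (mem_set KX) => /set_mem.
suff -> : X + t *: (Y - X) = t *: Y + (1 - t) *: X by [].
by apply/matrixP => i j; rewrite !mxE; ring.
Qed.

Lemma affine_hull_line F X Y t : F X -> F Y -> affine_hull F (X + t *: (Y - X)).
Proof.
move=> FX FY.
exists 2%N, (fun i => if i == 0 then 1 - t else t), (fun i => if i == 0 then X else Y).
split=> [i||]; first by case: ifP.
  by rewrite big_ord_recl big_ord1 /=; ring.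
rewrite big_ord_recl big_ord1 /=.
by apply/matrixP => i j; rewrite !mxE; ring.
Qed.

Lemma sub_affine_hull F : F `<=` affine_hull F.
Proof. by move=> X FX; have := affine_hull_line F X X 0 FX FX; rewrite scale0r addr0. Qed.

(** The hull contains the whole line through [A] and [B], so the first-order condition holds towards
    [B] and towards its reflection [2A - B]. *)
Lemma min_affine_hull F A B : F A -> min_norm_point (affine_hull F) A -> F B ->
  frob_dot B A = frob_dot A A.
Proof.
move=> FA [_ minA] FB; apply/eqP; rewrite eq_le; apply/andP; split; last first.
  by apply: min_segment => t _; apply: minA; exact: affine_hull_line.
have : frob_dot A A <= frob_dot (2%:R *: A - B) A.
  apply: min_segment => t _; apply: minA.
  suff -> : A + t *: (2%:R *: A - B - A) = A + (- t) *: (B - A).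
    exact: affine_hull_line.
  by apply/matrixP => i j; rewrite !mxE; ring.
by rewrite frob_dotBl frob_dotZl; lra.
Qed.

End Frobenius.

(** * Assignment duality, then faces of the Birkhoff polytope and their supports *)

Section Birkhoff.
Context {R : realType} {N : nat}.
Implicit Types (A B C E M X Y Z : 'M[R]_N) (F : set 'M[R]_N).

(** Dual variables come from potentials for the exchange weights [w] relative to an optimal
    permutation [s]; a positive cycle of [w] would improve [s]. *)
Lemma assignment_duality A : exists a b : 'I_N -> R,
  (forall i j, A i j <= a i + b j) /\ \sum_i a i + \sum_j b j = max_tr A.
Proof.
have [[s max_s] le_max] := max_trP A.
pose w i j := A i (s j) - A i (s i).
have [|u leu] := potential_exists w.
  move=> x p Up; rewrite -sum_next_cycle//.
  (* [c] shifts cyclically along the list and fixes everything else. *)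
  pose c := perm (can_inj (prev_next Up)).
  have -> : \sum_(i in x :: p) w i (next (x :: p) i) = \sum_i w i (c i).
    rewrite [RHS](bigID (fun i => i \in x :: p)) /= [X in _ = _ + X]big1 ?addr0.
      by apply: eq_bigr => i _; rewrite permE.
    move=> i ip; rewrite permE next_nth (negbTE ip) /w.
    by rewrite subrr.
  rewrite sumrB subr_le0 -[leRHS]/(perm_trace A s) -max_s.
  have -> : \sum_i A i (s (c i)) = perm_trace A (c * s)%g.
    by apply: eq_bigr => i _; rewrite permM.
  exact: le_max.
(* The bounds are tight along [s], and the potentials cancel in the total. *)
exists (fun i => A i (s i) + u i), (fun j => - u (s^-1%g j)); split.
  by move=> i j; have := leu i (s^-1%g j); rewrite /w permKV; lra.
rewrite big_split /= max_s sumrN [X in _ - X](reindex_inj (@perm_inj _ s)) /=.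
under [X in _ - X]eq_bigr do rewrite permK.
by rewrite addrK.
Qed.

Lemma frob_dot_le_max_tr A B : birkhoff R N B -> frob_dot B A <= max_tr A.
Proof.
case=> B0 rowB colB; have [a [b [le_ab <-]]] := assignment_duality A.
apply: (@le_trans _ _ (\sum_i \sum_j B i j * (a i + b j))).
  by apply: ler_sum => i _; apply: ler_sum => j _; apply: ler_wpM2l.
under eq_bigr do under eq_bigr do rewrite mulrDr.
under eq_bigr do rewrite big_split /= -mulr_suml rowB mul1r.
rewrite big_split /= exchange_big /=.
by under [X in _ + X]eq_bigr do rewrite -mulr_suml colB mul1r.
Qed.

Lemma frob_dot_perm_mx A (s : 'S_N) : frob_dot (perm_mx s) A = perm_trace A s.
Proof.
apply: eq_bigr => i _; rewrite (bigD1 (s i))//= big1 => [|j ne_j].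
  by rewrite !mxE eqxx mul1r addr0.
by rewrite !mxE eq_sym (negbTE ne_j) mul0r.
Qed.

Lemma birkhoff_perm_mx (s : 'S_N) : birkhoff R N (perm_mx s).
Proof.
split=> [i j|i|j]; first by rewrite !mxE ler0n.
  rewrite (bigD1 (s i))//= big1 => [|j ne_j]; first by rewrite !mxE eqxx addr0.
  by rewrite !mxE eq_sym (negbTE ne_j).
rewrite (bigD1 (s^-1%g j))//= big1 => [|i ne_i].
  by rewrite !mxE permKV eqxx addr0.
by rewrite !mxE -(inj_eq (@perm_inj _ s^-1%g)) permK (negbTE ne_i).
Qed.

(** [max_tr A] bounds [<., A>] on the polytope and is attained at a permutation matrix. *)
Lemma erdos_matrixP A : erdos_matrix A <->
  birkhoff R N A /\ forall B, birkhoff R N B -> frob_dot B A <= frob_dot A A.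
Proof.
rewrite /erdos_matrix sqr_sqrtr ?frob_dot_ge0//; split=> [[bA ->]|[bA leA]].
  by split=> // B; exact: frob_dot_le_max_tr.
split=> //; apply/eqP; rewrite eq_le frob_dot_le_max_tr//=.
have [[s ->] _] := max_trP A.
by rewrite -frob_dot_perm_mx; apply: leA; exact: birkhoff_perm_mx.
Qed.

(** The equations of the polytope without its inequalities, for affine moves that may leave it. *)
Definition unit_sums X :=
  (forall i, \sum_j X i j = 1) /\ (forall j, \sum_i X i j = 1).

Lemma unit_sums_affine X Y Z t : unit_sums X -> unit_sums Y -> unit_sums Z ->
  unit_sums (X + t *: (Y - Z)).
Proof.
move=> [rX cX] [rY cY] [rZ cZ]; split=> k; under eq_bigr do rewrite !mxE.
  by rewrite big_split /= -mulr_sumr sumrB rX rY rZ subrr mulr0 addr0.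
by rewrite big_split /= -mulr_sumr sumrB cX cY cZ subrr mulr0 addr0.
Qed.

Lemma birkhoff_unit_sums X : birkhoff R N X -> unit_sums X.
Proof. by case. Qed.

Lemma birkhoffE X : (forall i j, 0 <= X i j) -> unit_sums X -> birkhoff R N X.
Proof. by move=> X0 []. Qed.

Lemma birkhoff_segment X Y t : birkhoff R N X -> birkhoff R N Y -> 0 <= t <= 1 ->
  birkhoff R N (X + t *: (Y - X)).
Proof.
move=> bX bY /andP[t0 t1]; apply: birkhoffE => [i j|].
  have [[X0 _ _] [Y0 _ _]] := (bX, bY).
  have -> : (X + t *: (Y - X)) i j = (1 - t) * X i j + t * Y i j by rewrite !mxE; ring.
  by rewrite addr_ge0// mulr_ge0// subr_ge0.
by apply: unit_sums_affine; exact: birkhoff_unit_sums.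
Qed.

Lemma birkhoff_neq0 X : (1 <= N)%N -> birkhoff R N X -> X != 0.
Proof.
move=> N_gt0 [_ rX _]; apply/eqP => X0; have := rX (Ordinal N_gt0).
rewrite X0 big1 => [/esym/eqP|j _]; first by rewrite oner_eq0.
by rewrite mxE.
Qed.

Lemma segmentE (X Y : 'M[R]_N) (t : R) : (1 - t) *: X + t *: Y = X + t *: (Y - X).
Proof. by apply/matrixP => i j; rewrite !mxE; ring. Qed.

Lemma open_segment_sym X Y : open_segment Y X = open_segment X Y.
Proof.
apply/seteqP; split=> _ [t /= t01 <-]; exists (1 - t).
- by move: t01; rewrite /= !in_itv /=; lra.
- by rewrite subKr addrC.
- by move: t01; rewrite /= !in_itv /=; lra.
- by rewrite subKr addrC.
Qed.

Lemma birkhoff_open_segment X Y :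
  open_segment X Y `<=` birkhoff R N -> birkhoff R N X.
Proof.
move=> segP.
have bt t : 0 < t < 1 -> birkhoff R N (X + t *: (Y - X)).
  by move=> t01; apply: segP; exists t; rewrite ?segmentE//= in_itv.
apply: birkhoffE => [i j|].
  rewrite leNgt; apply/negP => X_lt0.
  set a := X i j in X_lt0; set b := `|Y i j|.
  have b0 : 0 <= b by exact: normr_ge0.
  have ba_gt0 : 0 < 2 * (b - a) by lra.
  (* At this parameter the entry is at most [a + t (b - a) = a / 2 < 0]. *)
  have t_gt0 : 0 < - a / (2 * (b - a)) by rewrite divr_gt0//; lra.
  have t_lt1 : - a / (2 * (b - a)) < 1 by rewrite ltr_pdivrMr// mul1r; lra.
  have [] := bt (- a / (2 * (b - a))); first by rewrite t_gt0.
  move=> /(_ i j) ge0 _ _; move: ge0; rewrite !mxE -/a.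
  set t := - a / _ in t_gt0 t_lt1 *.
  have tE : t * (b - a) = - a / 2 by rewrite /t; field; lra.
  have : t * (Y i j - a) <= t * (b - a).
    by rewrite ler_pM2l// lerD2r ler_norm.
  by rewrite tE; lra.
have h2 : birkhoff R N (X + 2^-1 *: (Y - X)) by apply: bt; lra.
have h4 : birkhoff R N (X + 4^-1 *: (Y - X)) by apply: bt; lra.
(* [X] is twice the quarter point minus the midpoint. *)
have -> : X = X + 4^-1 *: (Y - X) +
    1 *: (X + 4^-1 *: (Y - X) - (X + 2^-1 *: (Y - X))).
  by apply/matrixP => i j; rewrite !mxE; field.
by apply: unit_sums_affine; exact: birkhoff_unit_sums.
Qed.

Lemma exposed_face M (m : R) :
  (forall B, birkhoff R N B -> frob_dot B M <= m) ->
  (exists2 B, birkhoff R N B & frob_dot B M = m) ->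
  face (birkhoff R N) [set B | birkhoff R N B /\ frob_dot B M = m].
Proof.
move=> le_m [B0 bB0 B0m].
have seg X Y t : birkhoff R N X -> frob_dot X M = m -> birkhoff R N Y ->
    frob_dot Y M = m -> 0 <= t <= 1 ->
    birkhoff R N (X + t *: (Y - X)) /\ frob_dot (X + t *: (Y - X)) M = m.
  move=> bX Xm bY Ym t01; split; first exact: birkhoff_segment.
  by rewrite frob_dotDl frob_dotZl frob_dotBl Xm Ym subrr mulr0 addr0.
split.
- by exists B0.
- by move=> B [].
- move=> X Y t /set_mem[bX Xm] /set_mem[bY Ym]; apply/mem_set.
  have t01 : 0 <= t%:num <= 1 by rewrite ge0 le1.
  by have := seg _ _ _ bY Ym bX Xm t01; rewrite -segmentE addrC.
- move=> X Y segP [_ [[t /= + <-]]]; rewrite in_itv /= segmentE => t01 [_].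
  have bX := birkhoff_open_segment X Y segP.
  have bY : birkhoff R N Y.
    by apply: (birkhoff_open_segment Y X); rewrite open_segment_sym.
  rewrite frob_dotDl frob_dotZl frob_dotBl => tm.
  have leX := le_m _ bX; have leY := le_m _ bY.
  (* Both end values are at most [m], and an average of them with positive weights equals [m]. *)
  have Xm : frob_dot X M = m by nra.
  have Ym : frob_dot Y M = m by nra.
  by move=> _ [r /= + <-]; rewrite in_itv /= segmentE; exact: seg.
Qed.

Definition supp X : {set 'I_N * 'I_N} := [set ij | X ij.1 ij.2 != 0].

Lemma supp_subP X Y :
  reflect (forall i j, Y i j = 0 -> X i j = 0) (supp X \subset supp Y).
Proof.
apply: (iffP fintype.subsetP) => [sXY i j /eqP Y0|sXY [i j]]; last first.
  by rewrite !inE /=; apply: contra => /eqP/sXY->.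
by apply/eqP; apply: contraLR Y0 => X0; have := sXY (i, j); rewrite !inE /=; exact.
Qed.

(** Minus the indicator of the zero entries of [E] exposes this set: its product with [B] is at most
    0, with equality exactly when [B] vanishes there. *)
Lemma support_face E : birkhoff R N E ->
  face (birkhoff R N) [set B | birkhoff R N B /\ supp B \subset supp E].
Proof.
move=> bE; pose M : 'M[R]_N := \matrix_(i, j) - (E i j == 0)%:R.
have MB B : birkhoff R N B -> forall i j, B i j * M i j <= 0.
  by case=> B0 _ _ i j; rewrite mxE mulr_ge0_le0// oppr_le0.
have suppE B : birkhoff R N B -> (supp B \subset supp E) <-> frob_dot B M = 0.
  move=> bB; split=> [/supp_subP sBE|BM0].
    rewrite /frob_dot big1// => i _; rewrite big1// => j _; rewrite mxE.
    by case: eqP => [/sBE->|_]; rewrite ?mul0r// oppr0 mulr0.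
  have {}BM0 : \sum_i \sum_j - (B i j * M i j) = 0.
    by under eq_bigr do rewrite sumrN; rewrite sumrN; apply/eqP; rewrite oppr_eq0; apply/eqP.
  have ge0 i j : 0 <= - (B i j * M i j) by rewrite oppr_ge0 MB.
  apply/supp_subP => i j E0.
  have /(_ i isT) := psumr_eq0P (fun k _ => sumr_ge0 _ (fun l _ => ge0 k l)) BM0.
  move=> /(psumr_eq0P (fun l _ => ge0 i l)) /(_ j isT).
  by rewrite mxE E0 eqxx mulrN opprK mulr1.
have -> : [set B | birkhoff R N B /\ supp B \subset supp E] =
    [set B | birkhoff R N B /\ frob_dot B M = 0].
  by apply/seteqP; split=> B [bB /(suppE _ bB)].
apply: exposed_face => [B bB|]; last by exists E => //; exact/suppE.
by apply: sumr_le0 => i _; apply: sumr_le0 => j _; exact: MB.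
Qed.

Lemma small_perturbation C G : (forall i j, 0 <= C i j) ->
  exists2 s : R, 0 < s & forall i j, C i j != 0 -> 0 < C i j + s * G i j.
Proof.
move=> C0; pose K := \sum_i \sum_j `|G i j| / C i j.
have q0 i j : 0 <= `|G i j| / C i j by rewrite divr_ge0.
have K0 : 0 <= K by apply: sumr_ge0 => i _; apply: sumr_ge0.
have K1 : 0 < 1 + K by lra.
(* Where [C i j] is nonzero, [|G i j| <= K * C i j], hence
   [(1 + K) * C i j + G i j >= C i j > 0]. *)
exists (1 + K)^-1; first by rewrite invr_gt0.
move=> i j Cij; have Cgt : 0 < C i j by rewrite lt_def Cij C0.
have leK : `|G i j| / C i j <= K.
  rewrite /K (bigD1 i)//= (bigD1 j)//= -addrA lerDl addr_ge0// sumr_ge0// => k _.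
  exact: sumr_ge0.
rewrite -(pmulr_rgt0 _ K1) mulrDr mulrA mulfV ?gt_eqF// mul1r.
move: leK; rewrite ler_pdivrMr// => leK.
by have := ler_norm (- G i j); rewrite normrN; nra.
Qed.

(** Entries are nonnegative, so the support of a midpoint is the union of the two supports;
    averaging with a member not yet covered reduces the number of zeros. *)
Lemma face_full_support F : face (birkhoff R N) F ->
  exists2 C, F C & forall B, F B -> supp B \subset supp C.
Proof.
move=> [[X0 FX0] subP cF _].
suff H n X : F X -> (#|~: supp X| <= n)%N ->
    exists2 C, F C & forall B, F B -> supp B \subset supp C.
  exact: H FX0 (leqnn _).
elim: n X => [|n IH] X FX leX.
  exists X => // B _; apply/fintype.subsetP => x _.
  move: leX; rewrite leqn0 cards_eq0 => /eqP/setP/(_ x).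
  by rewrite finset.in_setC finset.in_set0 => /negbFE.
case: (EM (forall B, F B -> supp B \subset supp X)); first by exists X.
move=> /existsNP[B /not_implyP[FB /negP nsub]].
have FM := convex_setE _ _ _ 2^-1 cF FX FB.
apply: (IH (X + 2^-1 *: (B - X))); first by apply: FM; lra.
rewrite -ltnS (leq_trans _ leX)// proper_card// finset.properEneq.
have [X_ge0 _ _] := subP _ FX; have [B_ge0 _ _] := subP _ FB.
have sM i j : (X + 2^-1 *: (B - X)) i j = 0 -> X i j = 0 /\ B i j = 0.
  by rewrite !mxE; have := X_ge0 i j; have := B_ge0 i j; lra.
have sX : supp X \subset supp (X + 2^-1 *: (B - X)).
  by apply/supp_subP => i j /sM[].
have sB : supp B \subset supp (X + 2^-1 *: (B - X)).
  by apply/supp_subP => i j /sM[].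
rewrite finset.setCS sX andbT; apply: contra nsub => /eqP/(can_inj (@finset.setCK _)) <-.
exact: sB.
Qed.

(* [C] lies strictly between [B] and a point slightly beyond [C] on the line. *)
Lemma face_mem_support F C B : face (birkhoff R N) F -> F C ->
  birkhoff R N B -> supp B \subset supp C -> F B.
Proof.
move=> [_ subP _ fF] FC bB /supp_subP sBC.
have bC := subP _ FC; have [C0 _ _] := bC.
have [s s0 sP] := small_perturbation C (C - B) C0.
pose D := C + s *: (C - B).
have bD : birkhoff R N D.
  apply: birkhoffE => [i j|]; last by apply: unit_sums_affine; exact: birkhoff_unit_sums.
  have [CE|/sP/ltW] := eqVneq (C i j) 0; last by rewrite !mxE.
  by rewrite !mxE CE (sBC _ _ CE) subrr mulr0 addr0.
have s1 : 0 < 1 + s by lra.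
apply: (fF B D).
- move=> _ [t /= + <-]; rewrite in_itv /= segmentE => /andP[/ltW t0 /ltW t1].
  by apply: birkhoff_segment => //; rewrite t0.
(* [D - B = (1 + s) (C - B)] fixes the parameter of [C] on the segment. *)
- exists C; split=> //; exists (1 + s)^-1.
    by rewrite /= in_itv /= invr_gt0 s1 invf_lt1//; lra.
  by apply/matrixP => i j; rewrite !mxE; field; rewrite gt_eqF.
- by exists 0; rewrite /= ?in_itv /= ?lexx ?ler01// subr0 scale1r scale0r addr0.
Qed.

(* A ratio test: move from [C] towards [E] and away from [B], in the proportion
   at which a first entry outside the support of [C] vanishes. *)
Lemma shrink_support A C E B : birkhoff R N C -> birkhoff R N E ->
  birkhoff R N B -> supp C \subset supp E -> supp B \subset supp E ->
  ~~ (supp B \subset supp C) ->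
  frob_dot C A < frob_dot E A -> frob_dot B A < frob_dot C A ->
  exists E', [/\ birkhoff R N E', supp C \subset supp E',
    (#|supp E'| < #|supp E|)%N & frob_dot C A < frob_dot E' A].
Proof.
move=> bC bE bB sCE sBE nBC ltCE ltBC.
have [[[C0 _ _] [E0 _ _]] [B0 _ _]] := (bC, bE, bB).
case/subsetPn: nBC => k0; rewrite !inE => Bk0; rewrite negbK => Ck0.
pose P (k : 'I_N * 'I_N) := (B k.1 k.2 != 0) && (C k.1 k.2 == 0).
have Pk0 : P k0 by rewrite /P Bk0.
case: (arg_minP (fun k => E k.1 k.2 / B k.1 k.2) Pk0) => k /andP[Bk /eqP Ck] mink.
set r := E k.1 k.2 / B k.1 k.2 in mink.
have r0 : 0 <= r by rewrite divr_ge0.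
(* Where [C] vanishes, [G] is [E - r B]: nonnegative by the choice of [k], and zero at [k]. *)
pose G := (E - C) - r *: (B - C).
have G0 i j : C i j = 0 -> 0 <= G i j.
  move=> Cij; rewrite !mxE Cij !subr0 subr_ge0.
  have [->|Bij] := eqVneq (B i j) 0; first by rewrite mulr0.
  have := mink (i, j); rewrite /P /= Bij Cij eqxx => /(_ isT).
  by rewrite ler_pdivlMr// lt_def Bij B0.
have [s s0 sP] := small_perturbation C G C0.
(* In this form both increments are seen to raise [<., A>]. *)
have E'E : C + s *: G = C + s *: (E - C) + (s * r) *: (C - B).
  by apply/matrixP => i j; rewrite !mxE; ring.
exists (C + s *: G); split.
- apply: birkhoffE => [i j|].
    have [Cij|/sP/ltW] := eqVneq (C i j) 0; last by rewrite !mxE.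
    have := G0 _ _ Cij; rewrite [(C + _) i j]mxE [(s *: G) i j]mxE Cij add0r => G_ge0.
    by rewrite mulr_ge0// ltW.
  by rewrite E'E; do 2?apply: unit_sums_affine; exact: birkhoff_unit_sums.
- apply/supp_subP => i j E'0; apply/eqP; apply/negPn/negP => /sP.
  by move: E'0; rewrite [(C + _) i j]mxE [(s *: G) i j]mxE => ->; rewrite ltxx.
- apply: proper_card; apply/properP; split.
    apply/supp_subP => i j Eij; rewrite !mxE Eij.
    by rewrite (supp_subP _ _ sCE _ _ Eij) (supp_subP _ _ sBE _ _ Eij); ring.
  exists k; rewrite !inE.
    by apply: contra Bk => /eqP/(supp_subP _ _ sBE)->.
  by rewrite negbK !mxE Ck !subr0 /r divfK// subrr mulr0 addr0.
- rewrite E'E !frob_dotDl !frob_dotZl !frob_dotBl -addrA ltrDl ltr_wpDr//.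
    by apply: mulr_ge0; [rewrite mulr_ge0// ltW | rewrite subr_ge0 ltW].
  by rewrite mulr_gt0// subr_gt0.
Qed.

(** Induction on the support of [E]: if [<., A>] falls below [|A|^2] on the face of matrices
    supported in that of [E], [shrink_support] yields a smaller candidate. *)
Lemma increasing_face A F : face (birkhoff R N) F ->
  (forall B, F B -> frob_dot B A = frob_dot A A) ->
  (exists2 P, birkhoff R N P & frob_dot A A < frob_dot P A) ->
  exists F', [/\ face (birkhoff R N) F', F `<=` F',
    forall B, F' B -> frob_dot A A <= frob_dot B A &
    exists2 E, F' E & frob_dot A A < frob_dot E A].
Proof.
move=> fF FA [P bP ltP]; have [C FC sC] := face_full_support F fF.
have [_ subP _ _] := fF; have bC := subP _ FC; have CA := FA _ FC.
have [C0 _ _] := bC; have [P0 _ _] := bP.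
suff H n E : birkhoff R N E -> supp C \subset supp E ->
    frob_dot A A < frob_dot E A -> (#|supp E| <= n)%N ->
    exists F', [/\ face (birkhoff R N) F', F `<=` F',
      forall B, F' B -> frob_dot A A <= frob_dot B A &
      exists2 E, F' E & frob_dot A A < frob_dot E A].
  (* Averaging [P] with [C] makes the support contain that of [C] and keeps the value above
     [|A|^2]. *)
  apply: (H _ (C + 2^-1 *: (P - C))) (leqnn _).
  - by apply: birkhoff_segment => //; lra.
  - apply/supp_subP => i j; rewrite !mxE.
    by have := C0 i j; have := P0 i j; lra.
  - by rewrite frob_dotDl frob_dotZl frob_dotBl CA; lra.
elim: n E => [|n IH] E bE sCE ltE leE.
  have s0 : supp E = finset.set0 by apply/eqP; rewrite -cards_eq0 -leqn0.
  have EC : frob_dot E A = frob_dot A A.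
    by apply: FA; apply: (face_mem_support F C) => //; rewrite s0 finset.sub0set.
  by move: ltE; rewrite EC ltxx.
have [ge_m|] := EM (forall B, birkhoff R N B -> supp B \subset supp E ->
    frob_dot A A <= frob_dot B A).
  exists [set B | birkhoff R N B /\ supp B \subset supp E]; split.
  - exact: support_face.
  - by move=> B FB; split; [exact: subP | exact: fintype.subset_trans (sC _ FB) sCE].
  - by move=> B []; exact: ge_m.
  - by exists E.
move=> /existsNP[B /not_implyP[bB /not_implyP[sBE /negP]]]; rewrite -ltNge => ltB.
have nBC : ~~ (supp B \subset supp C).
  apply/negP => sBC; have FB := face_mem_support F C B fF FC bB sBC.
  by move: ltB; rewrite (FA _ FB) ltxx.
have [||E' [bE' sCE' ltE' ltE'A]] := shrink_support A C E B bC bE bB sCE sBE nBC.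
- by rewrite CA.
- by rewrite CA.
by apply: (IH E') => //; [rewrite -CA | rewrite -ltnS (leq_trans ltE')].
Qed.

End Birkhoff.

Theorem theorem5p4 (R : realType) (N : nat) (hN : (1 <= N)%N) (A : 'M[R]_N) :
  erdos_matrix A <->
  exists F : set 'M[R]_N,
    [/\ face (birkhoff R N) F,
        centered F,
        A = proj0 (affine_hull F) &
        forall F' : set 'M[R]_N,
          face (birkhoff R N) F' -> ~ centered F' -> F `<=` F' ->
          A <> proj0 F'].
Proof.
split=> [/erdos_matrixP[bA leA]|[F [fF cF AE noF']]].
  pose F := [set B | birkhoff R N B /\ frob_dot B A = frob_dot A A].
  have FA : F A by [].
  (* [<., A>] stays equal to [|A|^2] under affine combinations of members of [F]. *)
  have projF : proj0 (affine_hull F) = A.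
    apply: proj0_eq; first exact: sub_affine_hull.
    move=> _ [n [c [Y [FY c1 ->]]]]; rewrite frob_dot_suml.
    under [leRHS]eq_bigr => i _ do rewrite (FY i).2.
    by rewrite -mulr_suml c1 mul1r.
  exists F; split; rewrite /centered ?projF//; first by apply: exposed_face => //; exists A.
  move=> F' fF' ncF' sFF' AE; apply: ncF'.
  have [_ subP cF' _] := fF'.
  have [_ minA] : min_norm_point F' A.
    by rewrite AE; apply: proj0_min; rewrite -AE; exact: birkhoff_neq0 bA.
  (* Minimality of [A] on [F'] gives [<B, A> >= |A|^2] there; the Erdős property gives the
     converse. *)
  have FF' : F' = F.
    apply/seteqP; split=> // B F'B; split; first exact: subP.
    apply/eqP; rewrite eq_le leA/=; last exact: subP.
    by apply: min_segment => t t01; apply: minA; apply: convex_setE => //; exact: sFF'.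
  by rewrite FF' /centered projF.
have [_ subP _ _] := fF; have FA : F A by rewrite AE.
have bA := subP _ FA; have A0 := birkhoff_neq0 _ hN bA.
have minA : min_norm_point (affine_hull F) A.
  by rewrite AE; apply: proj0_min; rewrite -AE.
have FdA B : F B -> frob_dot B A = frob_dot A A by exact: min_affine_hull.
apply/erdos_matrixP; split=> // P bP; rewrite leNgt; apply/negP => ltP.
have [|F' [fF' sFF' geF' [E F'E ltE]]] := increasing_face A F fF FdA; first by exists P.
apply: (noF' F') => //; last by rewrite (@proj0_eq _ _ F' A)//; exact: sFF'.
rewrite /centered; set X := proj0 _ => F'X.
have [_ subP' _ _] := fF'.
have minX : min_norm_point (affine_hull F') X.
  by apply: proj0_min; exact: birkhoff_neq0 _ hN (subP' _ F'X).
have AX := min_affine_hull _ _ _ F'X minX (sFF' _ FA).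
(* From [<A, X> = |X|^2] follows [|X - A|^2 = |A|^2 - |X|^2], which is at most 0 since
   [<X, A> >= |A|^2]. *)
have XA : X = A.
  apply/eqP; rewrite -subr_eq0; apply/eqP/frob_dot_le0; rewrite frob_dot_sub.
  by have := geF' _ F'X; rewrite frob_dotC in AX; rewrite AX; lra.
by move: ltE; rewrite -XA (min_affine_hull _ _ _ F'X minX F'E) ltxx.
Qed.
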